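(* Let $F=\{F_n\}_{n\ge 0}$ be an arbitrary sequence of natural numbers with $F_0=1$ (the value $F_0=0$ being allowed exceptionally), and let $\Pi$ be the cobweb poset uniquely designated by $F$. Then the numbers $F_n$ ($n\ge 0$) are the incidence coefficients in the standard reduced incidence algebra $R(\Pi)$ of $\Pi$; that is, for all $k,l,n\in\mathbb{N}_0$ with $k\le l\le n$, $$\left\langle {k,\,n \atop l}\right\rangle = F_l .$$
   Context: $\mathbb{N}_0=\mathbb{N}\cup\{0\}$. Cobweb poset: for $s\in\mathbb{N}_0$ let $\Phi_s=\{\langle j,s\rangle : 1\le j\le F_s\}$ (in the exceptional case $F_0=0$, the level $\Phi_0$ is a one-element set consisting of an empty root). The cobweb poset designated by $F$ is $\Pi=(V,\le)$ with $V=\bigcup_{s\ge 0}\Phi_s$ and, for $x=\langle s,t\rangle$, $y=\langle u,v\rangle$: $x\le y$ iff $t<v$ or ($t=v$ and $s=u$). The rank function is $r(x)=s$ for $x\in\Phi_s$. For $x\le y$ the segment is $[x,y]=\{z\in\Pi: x\le z\le y\}$; $S(\Pi)$ is the set of all segments. $I(\Pi)$ is the incidence algebra of $\Pi$ over an associative ring with identity (functions $f(x,y)$ vanishing unless $x\le y$, with product $(f\ast g)(x,y)=\sum_{x\le z\le y}f(x,z)g(z,y)$). The standard reduced incidence algebra $R(\Pi)$ is the algebra of those $f\in I(\Pi)$ which take equal values on isomorphic segments. For $k\le n$ the type $(k,n)$ is $(k,n)=\{[x,y]\in S(\Pi): r(x)=k,\ r(y)=n\}$, and $(k,n)=\emptyset$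 for $k>n$. For $[x,y]\in(k,n)$ and $l\in\mathbb{N}_0$ the incidence coefficient in $R(\Pi)$ is $$\left\langle {k,\,n \atop l}\right\rangle=\bigl|\{z\in[x,y] : [x,z]\in(k,l)\ \text{and}\ [z,y]\in(l,n)\}\bigr|.$$
   Formalization: The formula is false for l = k or l = n when F_l ≠ 1 (only an endpoint is counted), so the coefficient is shown to be F_l for k < l < n and 1 for l = k or l = n; moreover every F_m is shown to occur as some coefficient (F_0 = 0 only as an empty count with l < k). *)

(* Defs.v *)
From HB Require Import structures.
From mathcomp Require Import all_boot all_order.
From mathcomp Require Import boolp classical_sets functions cardinality.
Set Implicit Arguments.
Unset Strict Implicit.
Unset Printing Implicit Defensive.
Import Order.TTheory.

Local Open Scope classical_set_scope.
Local Open Scope card_scope.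

(* The root level has one element also in the exceptional case F 0 = 0. *)
Definition level_size (F : nat -> nat) (s : nat) : nat :=
  if (s == 0) && (F 0 == 0) then 1 else F s.

(* The vertex <j, s> has coordinates (j, s): position j, counted from 1, in
   the level s. *)
Record cobweb (F : nat -> nat) : Type := Vertex {
  coords : nat * nat;
  _ : 1 <= coords.1 <= level_size F coords.2 }.

HB.instance Definition _ (F : nat -> nat) := [isSub for @coords F].
HB.instance Definition _ (F : nat -> nat) := [Countable of cobweb F by <:].

Definition rank (F : nat -> nat) (x : cobweb F) : nat := (coords x).2.

Definition cobweb_le (F : nat -> nat) (x y : cobweb F) : bool :=
  ((coords x).2 < (coords y).2) ||
  (((coords x).2 == (coords y).2) && ((coords x).1 == (coords y).1)).

Lemma cobweb_le_refl (F : nat -> nat) : reflexive (@cobweb_le F).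
Proof. by move=> x; rewrite /cobweb_le !eqxx orbT. Qed.

Lemma cobweb_le_anti (F : nat -> nat) : antisymmetric (@cobweb_le F).
Proof.
move=> x y /andP[] /orP[lt_xy|/andP[/eqP e2 /eqP e1] _].
  case/orP=> [lt_yx|/andP[/eqP e _]].
    by move: (ltn_trans lt_xy lt_yx); rewrite ltnn.
  by move: lt_xy; rewrite e ltnn.
apply: val_inj => /=; move: e1 e2.
by case: (coords x) (coords y) => [a b] [c d] /= -> ->.
Qed.

Lemma cobweb_le_trans (F : nat -> nat) : transitive (@cobweb_le F).
Proof.
move=> y x z /orP[lt_xy|/andP[/eqP e2 /eqP e1]]; last first.
  by rewrite /cobweb_le e2 e1.
case/orP=> [lt_yz|/andP[/eqP e _]]; rewrite /cobweb_le.
  by rewrite (ltn_trans lt_xy lt_yz).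
by rewrite -e lt_xy.
Qed.

Fact cobweb_display : Order.disp_t. Proof. exact: Order.Disp tt tt. Qed.

HB.instance Definition _ (F : nat -> nat) :=
  Order.Le_isPOrder.Build cobweb_display (cobweb F)
    (@cobweb_le_refl F) (@cobweb_le_anti F) (@cobweb_le_trans F).

Definition segment (F : nat -> nat) (x y : cobweb F) : set (cobweb F) :=
  [set z | (x <= z)%O /\ (z <= y)%O].

(* The type (k, n), a set of segments; it is empty when n < k. *)
Definition segment_type (F : nat -> nat) (k n : nat) : set (set (cobweb F)) :=
  [set s | exists x y : cobweb F,
     [/\ (x <= y)%O, rank x = k, rank y = n & s = segment x y]].

Arguments segment_type F k n s : clear implicits.

Definition intermediate (F : nat -> nat) (k n l : nat) (x y : cobweb F) :
    set (cobweb F) :=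
  [set z | [/\ segment x y z, segment_type F k l (segment x z)
             & segment_type F l n (segment z y)]].

Arguments intermediate F k n l x y z : clear implicits.

(* The incidence coefficient <k, n; l> is (well defined and) equal to c: there
   are segments of type (k, n), and each of them gives the cardinality c. *)
Definition incidence_coefficient_is (F : nat -> nat) (k n l c : nat) : Prop :=
  (exists x y : cobweb F, segment_type F k n (segment x y)) /\
  (forall x y : cobweb F, segment_type F k n (segment x y) ->
     intermediate F k n l x y #= `I_c).

(* Main.v *)
(* For k < l < n the points z of a segment of type (k, n) with rank l form the
   whole level l, since vertices of different ranks are always comparable; for
   l = k or l = n only the endpoint itself is left, and for l < k nothing, which
   provides the value F 0 = 0 of the exceptional case. *)
Require Import Defs.
From mathcomp Require Import all_boot all_order.
From mathcomp Require Import boolp classical_sets functions cardinality.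

Set Implicit Arguments.
Unset Strict Implicit.
Unset Printing Implicit Defensive.
Import Order.TTheory.

Local Open Scope classical_set_scope.
Local Open Scope card_scope.

(* A type only contains nonempty segments, and the endpoints of a nonempty
   segment are its minimum and its maximum. *)
Lemma segment_typeE (F : nat -> nat) (k n : nat) (x y : cobweb F) :
  segment_type F k n (segment x y) <->
  [/\ (x <= y)%O, rank x = k & rank y = n].
Proof.
split=> [[x' [y' [le' <- <- eqs]]]|[le_xy rx ry]]; last by exists x, y; split.
have [le_xx' _] : segment x y x' by rewrite eqs; split.
have [_ le_y'y] : segment x y y' by rewrite eqs; split.
have le_xy : (x <= y)%O by exact: le_trans le_xx' (le_trans le' le_y'y).
have [le_x'x _] : segment x' y' x by rewrite -eqs; split.
have [_ le_yy'] : segment x' y' y by rewrite -eqs; split.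
have -> : x' = x by apply/le_anti; rewrite le_x'x le_xx'.
by have -> : y' = y by apply/le_anti; rewrite le_y'y le_yy'.
Qed.

Lemma lt_rank_le (F : nat -> nat) (x y : cobweb F) :
  rank x < rank y -> (x <= y)%O.
Proof. by move=> lt_xy; apply/orP; left. Qed.

Lemma le_rank (F : nat -> nat) (x y : cobweb F) :
  (x <= y)%O -> rank x <= rank y.
Proof. by case/orP=> [/ltnW //|/andP[/eqP e _]]; rewrite /rank e. Qed.

(** Each level is an antichain: equal ranks exclude the strict alternative in [cobweb_le], which
    leaves equality of both coordinates. *)
Lemma le_rank_eq (F : nat -> nat) (x y : cobweb F) :
  (x <= y)%O -> rank x = rank y -> x = y.
Proof.
move=> le_xy rxy; apply/le_anti; rewrite le_xy /=.
case/orP: le_xy => [|/andP[/eqP e2 /eqP e1]].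
  by rewrite -!/(rank _) rxy ltnn.
by apply/orP; right; rewrite e1 e2 !eqxx.
Qed.

(** The ranks of [x] and [y] are fixed by the type, so the two conditions on subsegments say no more
    than that [z] has rank [l]. Counting reduces to cutting a segment with a level. *)
Lemma intermediateE (F : nat -> nat) (k n l : nat) (x y : cobweb F) :
  segment_type F k n (segment x y) ->
  intermediate F k n l x y = segment x y `&` [set z | rank z = l].
Proof.
move=> /segment_typeE[_ rx ry]; apply/seteqP; split=> z.
  by case=> sz /segment_typeE[_ _ rz] _; split.
by case=> -[xz zy] rz; split; [split|apply/segment_typeE|apply/segment_typeE].
Qed.

Lemma level_size_gt0 (F : nat -> nat) (s : nat) :
  (forall s, 0 < s -> 0 < F s) -> 0 < level_size F s.
Proof.
move=> hF; rewrite /level_size; case: s => [|s] /=; last exact: hF.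
by case: (F 0).
Qed.

Lemma segment_type_nonempty (F : nat -> nat) (k n : nat) :
  (forall s, 0 < s -> 0 < F s) -> k <= n ->
  exists x y : cobweb F, segment_type F k n (segment x y).
Proof.
move=> hF le_kn; have one_level s : 1 <= 1 <= level_size F s.
  exact: level_size_gt0.
(* Position 1 exists on every level; using it at both ends makes them coincide, hence comparable,
   when [k = n]. *)
exists (@Vertex F (1, k) (one_level k)), (@Vertex F (1, n) (one_level n)).
apply/segment_typeE; split=> //; apply/orP => /=.
by move: le_kn; rewrite leq_eqVlt andbT => /orP[->|->]; [right|left].
Qed.

Lemma card_level (F : nat -> nat) (l : nat) :
  [set z : cobweb F | rank z = l] #= `I_(level_size F l).
Proof.
(* Positions start at 1, the elements of [I_c] at 0. *)
pose pos (z : cobweb F) := (coords z).1.-1.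
have <- : pos @` [set z | rank z = l] = `I_(level_size F l).
  apply/seteqP; split=> [_ [[[j s] /= js] <- <-]|j /= ltj].
    by rewrite /pos /=; case: j js.
  have hj : 1 <= (j.+1, l).1 <= level_size F (j.+1, l).2 by [].
  by exists (@Vertex F (j.+1, l) hj).
rewrite card_eq_sym; apply: inj_card_eq.
move=> [[i s] /= hi] [[j t] /= hj]; rewrite !inE /= /rank /pos /= => es et eij.
apply: val_inj => /=; rewrite es et.
(* The predecessor identifies 0 and 1, but 0 is not a position, so it is injective here. *)
by case: i j hi hj eij => [|i] [|j] //= _ _ ->.
Qed.

Lemma incidence_coefficient_interior (F : nat -> nat) (k l n : nat) :
  (forall s, 0 < s -> 0 < F s) -> k < l -> l < n ->
  incidence_coefficient_is F k n l (F l).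
Proof.
move=> hF lt_kl lt_ln; split=> [|x y xy].
  exact: segment_type_nonempty (ltnW (ltn_trans lt_kl lt_ln)).
have [_ rx ry] := (segment_typeE _ _ _ _).1 xy.
rewrite intermediateE //.
have -> : segment x y `&` [set z | rank z = l] = [set z | rank z = l].
  apply/setIidr => z /= rz.
  by split; apply: lt_rank_le; rewrite ?rx ?ry rz.
(* From [k < l] the level [l] is not the root level, so the convention for [F 0 = 0] does not
   intervene. *)
have <- : level_size F l = F l by rewrite /level_size; case: l lt_kl {lt_ln}.
exact: card_level.
Qed.

Lemma incidence_coefficient_boundary (F : nat -> nat) (k l n : nat) :
  (forall s, 0 < s -> 0 < F s) -> k <= n -> l = k \/ l = n ->
  incidence_coefficient_is F k n l 1.
Proof.
move=> hF le_kn lkn; split=> [|x y xy]; first exact: segment_type_nonempty.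
have [le_xy rx ry] := (segment_typeE _ _ _ _).1 xy.
rewrite intermediateE //.
suff [z ->] : exists z, segment x y `&` [set z | rank z = l] = [set z].
  exact: card_set1.
(* A vertex of the segment sharing the rank of an endpoint is comparable to it, hence equal to
   it. *)
case: lkn => ->; [exists x|exists y]; apply/seteqP; split=> z.
- case=> -[xz _] rz; apply/esym/le_rank_eq => //.
  by rewrite rx.
- by move=> ->; split=> //; split.
- case=> -[_ zy] rz; apply: le_rank_eq => //.
  by rewrite ry.
- by move=> ->; split=> //; split.
Qed.

Lemma incidence_coefficient_below (F : nat -> nat) (k l n : nat) :
  (forall s, 0 < s -> 0 < F s) -> k <= n -> l < k ->
  incidence_coefficient_is F k n l 0.
Proof.
move=> hF le_kn lt_lk; split=> [|x y xy]; first exact: segment_type_nonempty.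
have [_ rx _] := (segment_typeE _ _ _ _).1 xy.
rewrite II0 card_eq0 intermediateE //; apply/eqP/seteqP; split=> // z.
case=> -[/le_rank + _] rz; rewrite rx rz leqNgt.
by rewrite lt_lk.
Qed.

Theorem theorem1 (F : nat -> nat)
    (hF0 : F 0 = 1 \/ F 0 = 0) (hF : forall s : nat, 0 < s -> 0 < F s) :
  (forall k l n : nat, k < l -> l < n ->
     incidence_coefficient_is F k n l (F l)) /\
  (forall k l n : nat, k <= l -> l <= n -> l = k \/ l = n ->
     incidence_coefficient_is F k n l 1) /\
  (forall m : nat, exists k n : nat, incidence_coefficient_is F k n m (F m)).
Proof.
split; first by move=> k l n; apply: incidence_coefficient_interior.
split=> [k l n kl ln|[|m]].
- by apply: incidence_coefficient_boundary => //; exact: leq_trans ln.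
(* If [F 0 = 1], type [(0, 0)] yields the value 1; if [F 0 = 0], type [(1, 1)] yields 0, since its
   segments contain no vertex of rank 0. *)
- case: hF0 => ->.
    by exists 0, 0; apply: incidence_coefficient_boundary => //; left.
  by exists 1, 1; apply: incidence_coefficient_below.
(* A positive index [m.+1] lies strictly between its two neighbours. *)
- by exists m, m.+2; apply: incidence_coefficient_interior.
Qed.
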